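(* For every integer $n \geq 2$, if $S_n$ is the star of order $n$ (i.e. $S_n \cong K_{1,n-1}$), then $d(S_n) = n-1$.
   Context: Graphs are finite and simple. The deduction game on a graph $G$: a layout is a placement of searchers on vertices of $G$ (a vertex may receive several searchers). A vertex is occupied in the layout if it contains at least one searcher, and unoccupied otherwise. A vertex is protected if it is occupied in the initial layout or if a searcher has moved there at some point, and unprotected otherwise. A vertex is fireable if the number of searchers on it is greater than or equal to the number of its unprotected neighbours. Initially every searcher is mobile; once a searcher has moved once, it becomes immobile (cannot move again). At each stage, simultaneously, for every fireable vertex $v$ containing mobile searchers, one searcher moves from $v$ to each unprotected neighbour of $v$ (excess searchers stay on $v$; several fireable vertices may send a searcher to the same target). Stages continue until no new searchers move. The layout is successful if at the end all vertices of $G$ are protected. The deduction number $d(G)$ is the minimum number of searchers in a successful layout on $G$. *)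

(* Defs.v *)
From HB Require Import structures.
From mathcomp Require Import all_boot.

Set Implicit Arguments.
Unset Strict Implicit.
Unset Printing Implicit Defensive.

Record sgraph := SGraph {
  vertex :> finType;
  adj : rel vertex;
  adj_sym : symmetric adj;
  adj_irr : irreflexive adj }.

Definition isomorphic (G H : sgraph) : Prop :=
  exists2 f : G -> H, bijective f & forall x y, adj (f x) (f y) = adj x y.

Section CompleteBipartite.
Variables m n : nat.

Definition bip_adj : rel ('I_m + 'I_n)%type := fun x y =>
  match x, y with inl _, inr _ | inr _, inl _ => true | _, _ => false end.

Lemma bip_adj_sym : symmetric bip_adj. Proof. by case=> ? []. Qed.
Lemma bip_adj_irr : irreflexive bip_adj. Proof. by case. Qed.

Definition complete_bipartite := SGraph bip_adj_sym bip_adj_irr.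
End CompleteBipartite.

(* Order n counts the centre, so this is meant for 0 < n. *)
Definition is_star (n : nat) (G : sgraph) : Prop :=
  isomorphic G (complete_bipartite 1 (n - 1)).

Section DeductionGame.
Variable G : sgraph.

(* Searchers on the same vertex with the same mobility are interchangeable, so
   a position of the game only records their numbers. *)
Record state := State {
  mobile : {ffun G -> nat};
  immobile : {ffun G -> nat};
  protected : {set G} }.

Implicit Types (s : state) (v w : G).

Definition searchers s v : nat := mobile s v + immobile s v.

Definition unprotected_nbrs s v : {set G} :=
  [set w | adj v w & w \notin protected s].

Definition fireable s v : bool := #|unprotected_nbrs s v| <= searchers s v.

Definition fires s v : bool := fireable s v && (0 < mobile s v).

(* The truncated subtraction is exact on positions reached from a layout, see
   fires_enough_mobile. *)
Definition stage s : state := State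
  [ffun v => if fires s v then mobile s v - #|unprotected_nbrs s v|
             else mobile s v]
  [ffun w => immobile s w + #|[set v | fires s v & w \in unprotected_nbrs s v]|]
  (protected s :|: \bigcup_(v | fires s v) unprotected_nbrs s v).

Definition terminal s : bool :=
  [forall v, fires s v ==> (unprotected_nbrs s v == set0)].

(* A layout of d searchers maps each searcher to its vertex. *)
Definition initial d (L : {ffun 'I_d -> G}) : state := State
  [ffun v => #|[set i | L i == v]|] [ffun=> 0] [set L i | i : 'I_d].

(* #|G| stages are enough for the game to stop, see terminal_outcome; further
   stages do not change the position, see stage_terminal. *)
Definition outcome d (L : {ffun 'I_d -> G}) : state :=
  iter #|G| stage (initial L).

Definition successful d (L : {ffun 'I_d -> G}) : bool :=
  protected (outcome L) == [set: G].

Lemma stage_terminal s : terminal s -> stage s = s.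
Proof.
move=> /forallP ts.
have nb0 v : fires s v -> unprotected_nbrs s v = set0.
  by move=> fv; apply/eqP; move: (ts v); rewrite fv.
case: s ts nb0 => m i p ts nb0; rewrite /stage /=; congr State.
- apply/ffunP=> v; rewrite ffunE; case: ifP => // /nb0 ->.
  by rewrite cards0 subn0.
- apply/ffunP=> w; rewrite ffunE eq_card0 ?addn0 // => v; rewrite inE.
  by apply/andP => -[/nb0 ->]; rewrite inE.
- by rewrite big1 ?setU0.
Qed.

Lemma stage_protected s : ~~ terminal s -> #|protected s| < #|protected (stage s)|.
Proof.
move=> /forallPn[v]; rewrite negb_imply => /andP[fv /set0Pn[w wv]].
apply: proper_card; rewrite properE subsetUl /=.
apply/subsetPn; exists w; last by move: wv; rewrite inE => /andP[].
by rewrite inE; apply/orP; right; apply/bigcupP; exists v.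
Qed.

Lemma terminal_outcome d (L : {ffun 'I_d -> G}) : terminal (outcome L).
Proof.
have grow k : terminal (iter k stage (initial L)) ||
    (k <= #|protected (iter k stage (initial L))|).
  elim: k => [|k /orP[tk|lek]]; first by rewrite orbT.
    by rewrite iterS stage_terminal // tk.
  have [tk|ntk] := boolP (terminal (iter k stage (initial L))).
    by rewrite iterS stage_terminal // tk.
  by rewrite [_ <= _](leq_ltn_trans lek) ?orbT // iterS stage_protected.
have /orP[//|full] := grow #|G|.
have protT : protected (outcome L) = setT.
  by apply/eqP; rewrite eqEcard subsetT cardsT.
apply/forallP=> v; apply/implyP=> _; apply/eqP/setP=> w.
by rewrite !inE protT inE andbF.
Qed.

Lemma fires_enough_mobile d (L : {ffun 'I_d -> G}) k v :
  fires (iter k stage (initial L)) v ->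
  #|unprotected_nbrs (iter k stage (initial L)) v|
    <= mobile (iter k stage (initial L)) v.
Proof.
have inv : let s := iter k stage (initial L) in
    forall w, 0 < mobile s w -> w \in protected s /\ immobile s w = 0.
  elim: k => [|k IHk] /= w.
    rewrite /initial /= !ffunE => /card_gt0P[i]; rewrite inE => /eqP <-.
    by split=> //; apply: imset_f.
  set s := iter k stage (initial L) in IHk *.
  rewrite ffunE => m_gt0.
  have {m_gt0}[wp im0] : w \in protected s /\ immobile s w = 0.
    apply: IHk; move: m_gt0; case: ifP => // _ /leq_trans; apply; exact: leq_subr.
  rewrite inE wp ffunE im0; split=> //; apply/eqP.
  by rewrite add0n cards_eq0; apply/eqP/setP=> u; rewrite !inE wp !andbF.
by case/andP=> + m_gt0; rewrite /fireable /searchers; case: (inv v m_gt0) => _ ->;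
  rewrite addn0.
Qed.

Definition has_successful_layout (d : nat) : bool :=
  [exists L : {ffun 'I_d -> G}, successful L].

Lemma ex_successful_layout : exists d, has_successful_layout d.
Proof.
exists #|G|; apply/existsP; exists [ffun i => enum_val i].
have sub k s : protected s \subset protected (iter k stage s).
  by elim: k => //= k /subset_trans; apply; apply: subsetUl.
rewrite /successful eqEsubset subsetT; apply: subset_trans (sub _ _).
apply/subsetP=> v _; apply/imsetP; exists (enum_rank v) => //.
by rewrite ffunE enum_rankK.
Qed.

Definition deduction_number : nat := ex_minn ex_successful_layout.

End DeductionGame.

(* Main.v *)
Require Import Defs.
From HB Require Import structures.
From mathcomp Require Import all_boot.

(** The star has [n] vertices, and its [n - 1] leaves form an independent set.
    Both bounds hold in any graph.

    Lower bound ([independent_leq_deduction_number]): the deduction number is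
    at least the size of any independent set [I].  A vertex of [I] is reached
    only from outside [I], so each vertex of [I] protected during the game uses
    up a searcher that was mobile outside [I]; hence the number of protected
    vertices in [I] plus the number of mobile searchers outside [I] never
    increases.  It starts at no more than the number of searchers, and it ends
    at no less than the size of [I] if the layout is successful.

    Upper bound ([deduction_number_ltn_card]): in a graph with an edge [v c],
    one searcher on each vertex other than [c] suffices, because [c] is then the
    only unprotected neighbour of [v], and [v] fires at the first stage. *)

Set Implicit Arguments.
Unset Strict Implicit.
Unset Printing Implicit Defensive.

Lemma leq_card_bigcup (I T : finType) (P : pred I) (F : I -> {set T}) :
  #|\bigcup_(i | P i) F i| <= \sum_(i | P i) #|F i|.
Proof.
elim/big_rec2: _ => [|i m A _ leAm]; first by rewrite cards0.
by rewrite (leq_trans (leq_card_setU _ _).1) // leq_add2l.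
Qed.

Section DeductionBounds.
Variable G : sgraph.
Implicit Types (s : state G) (A I : {set G}).

Definition independent I : Prop := {in I &, forall v w, ~~ adj v w}.

Definition potential I s : nat :=
  #|protected s :&: I| + \sum_(v in ~: I) mobile s v.

Lemma initial_potential I d (L : {ffun 'I_d -> G}) :
  potential I (initial L) <= d.
Proof.
rewrite /potential.
have -> : \sum_(v in ~: I) mobile (initial L) v = #|[set i | L i \notin I]|.
  rewrite -sum1_card (partition_big L (mem (~: I))) /=; last first.
    by move=> i; rewrite !inE.
  apply: eq_bigr => v; rewrite inE => vI; rewrite ffunE -sum1_card.
  apply: eq_bigl => i; rewrite !inE.
  by case: eqP => [->|]; rewrite ?andbF ?vI.
have sub : protected (initial L) :&: I \subset L @: [set i | L i \in I].
  apply/subsetP=> v; rewrite inE => /andP[/imsetP[i _ ->] iI].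
  by apply: imset_f; rewrite inE.
rewrite -[leqRHS]card_ord -(cardsC [set i | L i \in I]).
apply: leq_add; first exact: leq_trans (subset_leq_card sub) (leq_imset_card _ _).
by apply: subset_leq_card; apply/subsetP=> i; rewrite !inE.
Qed.

(** The hypothesis on mobile searchers makes the subtraction in [stage] exact,
    so that every firing vertex outside [I] loses as many mobile searchers as it
    protects vertices. *)
Lemma stage_potential I s : independent I ->
    (forall v, fires s v -> #|unprotected_nbrs s v| <= mobile s v) ->
  potential I (stage s) <= potential I s.
Proof.
move=> indI enough; rewrite /potential.
have -> : \sum_(v in ~: I) mobile s v =
    \sum_(v in ~: I | fires s v) #|unprotected_nbrs s v|
    + \sum_(v in ~: I) mobile (stage s) v.
  rewrite big_mkcondr -big_split /=; apply: eq_bigr => v _.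
  by rewrite ffunE; case: ifP => // /enough /subnKC.
rewrite addnA leq_add2r; apply: leq_trans (leq_add (leqnn _) (leq_card_bigcup _ _)).
apply: leq_trans (leq_card_setU _ _).1; apply: subset_leq_card.
apply/subsetP=> w; rewrite !inE => /andP[/orP[->->//|/bigcupP[v fv vw] wI]].
apply/orP; right; apply/bigcupP; exists v => //; rewrite inE fv andbT.
apply/negP=> vI; move: vw; rewrite inE => /andP[avw _].
by have := indI v w vI wI; rewrite avw.
Qed.

Lemma independent_leq_deduction_number I :
  independent I -> #|I| <= deduction_number G.
Proof.
move=> indI; rewrite /deduction_number.
case: ex_minnP => d /existsP[L /eqP full] _.
suff le_d k : potential I (iter k (@stage G) (initial L)) <= d.
  apply: leq_trans (le_d #|G|); rewrite /potential -/(outcome L) full setTI.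
  exact: leq_addr.
elim: k => [|k IHk]; first exact: initial_potential.
rewrite iterS; apply: leq_trans IHk; apply: stage_potential => // v.
exact: fires_enough_mobile.
Qed.

Lemma iter_stage_protected k s : protected s \subset protected (iter k (@stage G) s).
Proof. by elim: k => //= k /subset_trans; apply; apply: subsetUl. Qed.

Lemma deduction_number_ltn_card (v c : G) : adj v c -> deduction_number G < #|G|.
Proof.
move=> avc; rewrite -cardsT (cardsD1 c) in_setT add1n ltnS.
set A := [set: G] :\ c; rewrite /deduction_number.
case: ex_minnP => d _; apply; apply/existsP.
pose L := [ffun i : 'I_#|A| => enum_val i]; exists L.
have vc : v != c by apply: contraTneq avc => ->; rewrite adj_irr.
have vA : v \in A by rewrite !inE vc.
have protL : protected (initial L) = A.
  apply/setP=> w; apply/imsetP/idP=> [[i _ ->]|wA]; first by rewrite ffunE enum_valP.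
  by exists (enum_rank_in wA w); rewrite // ffunE enum_rankK_in.
have nbrsv : unprotected_nbrs (initial L) v = [set c].
  apply/setP=> w; rewrite !inE protL !inE andbT negbK.
  by case: eqP => [->|]; rewrite ?avc ?andbF.
have mobv : 0 < mobile (initial L) v.
  rewrite ffunE; apply/card_gt0P; exists (enum_rank_in vA v).
  by rewrite inE ffunE enum_rankK_in.
have fv : fires (initial L) v.
  by rewrite /fires /fireable nbrsv cards1 mobv andbT (leq_trans mobv) // leq_addr.
have Ggt0 : 0 < #|G| by apply/card_gt0P; exists v.
rewrite /successful eqEsubset subsetT /outcome -(prednK Ggt0) iterSr.
apply: subset_trans (iter_stage_protected _ _).
apply/subsetP=> w _; rewrite !inE protL !inE andbT.
have [->|//] := eqVneq w c.
by apply/bigcupP; exists v; rewrite // nbrsv set11.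
Qed.

End DeductionBounds.

Theorem theorem4p7 (n : nat) (Sn : sgraph) (hn : 2 <= n) (hS : is_star n Sn) :
  deduction_number Sn = n - 1.
Proof.
case: hS => f [g fK gK] f_adj.
have n1 : 0 < n - 1 by rewrite subn_gt0.
have cardS : #|Sn| = (n - 1).+1.
  by rewrite (bij_eq_card (Bijective fK gK)) card_sum !card_ord.
pose c := g (inl ord0).
have adjc : adj (g (inr (Ordinal n1))) c by rewrite -f_adj !gK.
have indS : independent (~: [set c]).
  have leaf v : v \in ~: [set c] -> exists i, f v = inr i.
    rewrite !inE -(can_eq fK) gK; case: (f v) => [i|i _]; last by exists i.
    by rewrite (ord1 i) eqxx.
  by move=> v w /leaf[i fv] /leaf[j fw]; rewrite -f_adj fv fw.
apply/eqP; rewrite eqn_leq -ltnS -cardS (deduction_number_ltn_card adjc).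
apply: leq_trans (independent_leq_deduction_number indS).
by rewrite cardsC1 cardS.
Qed.
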